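(* Let $K$ be a compact space which has a retractional skeleton, let $D\subset K$ be a set induced by a retractional skeleton in $K$, and let $(Y_n)_{n\in\mathbb{N}}$ be a sequence of $\tau_p(D)$-closed linear subspaces of $\mathcal{C}(K)$. Then there exists a $1$-projectional skeleton $\{P_s\}_{s\in\Gamma}$ in $\mathcal{C}(K)$ such that $P_s(Y_n)\subset Y_n$ for all $n\in\mathbb{N}$ and $s\in\Gamma$. In particular, for every $n\in\mathbb{N}$, $\{P_s\upharpoonright_{Y_n}\}_{s\in\Gamma}$ is a $1$-projectional skeleton in $Y_n$.
   Context: All topological spaces are Hausdorff; Banach spaces are real. $\mathcal{C}(K)$ is the Banach space of continuous real functions on $K$ with the supremum norm. For a dense set $D\subset K$, $\tau_p(D)$ is the topology on $\mathcal{C}(K)$ of pointwise convergence on $D$. A partially ordered set $\Gamma$ is up-directed if any two elements have an upper bound in $\Gamma$, and $\sigma$-complete if every increasing sequence in $\Gamma$ has a supremum in $\Gamma$. A projectional skeleton in a Banach space $X$ is a family $\{P_s\}_{s\in\Gamma}$ of bounded linear projections on $X$, indexed by an up-directed $\sigma$-complete partially ordered set $\Gamma$, such that: (i) each $P_sX$ is separable; (ii) $X=\bigcup_{s\in\Gamma}P_sX$; (iii) $s\le t\Rightarrow P_s=P_s\circ P_t=P_t\circ P_s$; (iv) if $s_1<s_2<\cdots$ in $\Gamma$ and $t=\sup_n s_n$, then $P_tX=\overline{\bigcup_n P_{s_n}X}$. It is an $r$-projectional skeleton ($r\ge1$) if moreover $\|P_s\|\le r$ for all $s\in\Gamma$.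 A retractional skeleton in a compact space $K$ is a family $\{r_s\}_{s\in\Gamma}$ of (continuous) retractions of $K$ into itself, indexed by an up-directed $\sigma$-complete partially ordered set $\Gamma$, such that: (i) $r_s[K]$ is metrizable for each $s$; (ii) $x=\lim_{s\in\Gamma}r_s(x)$ for every $x\in K$; (iii) $s\le t\Rightarrow r_s=r_s\circ r_t=r_t\circ r_s$; (iv) if $s_1<s_2<\cdots$ in $\Gamma$ and $t=\sup_n s_n$, then $r_t(x)=\lim_n r_{s_n}(x)$ for every $x\in K$. The set induced by this retractional skeleton is $\bigcup_{s\in\Gamma}r_s[K]$ (it is dense in $K$). *)

(* Defs.v *)
From HB Require Import structures.
From mathcomp Require Import all_boot all_order all_algebra.
From mathcomp Require Import all_classical all_reals all_analysis.
From mathcomp Require Import ring.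

Set Implicit Arguments.
Unset Strict Implicit.
Unset Printing Implicit Defensive.

Import Order.TTheory GRing.Theory Num.Theory.
Import numFieldNormedType.Exports.

Local Open Scope classical_set_scope.
Local Open Scope ring_scope.

HB.mixin Record isCompactHausdorff T of Topological T := {
  compact_setT : compact [set: T];
  hausdorff_setT : hausdorff_space T
}.

#[short(type="compactHausdorffType")]
HB.structure Definition CompactHausdorff :=
  {T of Topological T & isCompactHausdorff T}.

Section ContinuousFunctions.
Context (R : realType) (K : compactHausdorffType).

(* The alias keeps the topology of the supremum norm apart from the topologies
   that the library puts on [continuousType K R]. *)
Definition Cspace : Type := continuousType K R.

Definition cts_pred : {pred K -> R} := mem [set f : K -> R | continuous f].

Definition Cspace_fun (f : Cspace) : K -> R := Continuous.sort f.
Coercion Cspace_fun : Cspace >-> Funclass.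

Lemma Cspace_cts (f : Cspace) : continuous f.
Proof. exact: (@cts_fun K R f). Qed.

Definition Cspace_Sub (f : K -> R) (hf : f \in cts_pred) : Cspace :=
  HB.pack_for (continuousType K R) f (@isContinuous.Build K R f (set_mem hf)).

Lemma Cspace_rect (T : Cspace -> Type) :
  (forall f (hf : f \in cts_pred), T (Cspace_Sub hf)) -> forall u, T u.
Proof.
move=> H u; have hu : (u : K -> R) \in cts_pred by apply/mem_set/Cspace_cts.
suff -> : u = Cspace_Sub hu by exact: H.
exact/continuousEP.
Qed.

HB.instance Definition _ :=
  @isSub.Build (K -> R) cts_pred Cspace Cspace_fun Cspace_Sub Cspace_rect
    (fun f hf => erefl).
HB.instance Definition _ := Choice.copy Cspace (continuousType K R).

Lemma cts_submod_closed : submod_closed cts_pred.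
Proof.
split; first by apply/mem_set => x; exact: cvg_cst.
move=> a f g /set_mem hf /set_mem hg; apply/mem_set => x.
apply: cvgD; last exact: hg.
by apply: cvgM; [exact: cvg_cst|exact: hf].
Qed.

HB.instance Definition _ :=
  GRing.isSubmodClosed.Build _ _ cts_pred cts_submod_closed.
HB.instance Definition _ := [SubChoice_isSubLmodule of Cspace by <:].

Lemma Cspace_eqP (f g : Cspace) : (forall x, f x = g x) -> f = g.
Proof. by move=> fg; apply: val_inj; apply/funext. Qed.

(* Total even for empty [K], where [sup set0 = 0] and [Cspace] is trivial. *)
Definition supnorm (f : Cspace) : R := sup [set `|f x| | x in [set: K]].

Lemma Cspace_bounded (f : Cspace) : has_ubound [set `|f x| | x in [set: K]].
Proof.
have : compact [set `|f x| | x in [set: K]].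
  apply: continuous_compact; last exact: compact_setT.
  apply: continuous_subspaceT => x.
  by apply: continuous_comp; [exact: Cspace_cts|exact: norm_continuous].
move=> /compact_bounded[M [_ hM]]; exists (M + 1) => y hy.
apply: le_trans (ler_norm _) _.
by apply: hM hy; rewrite ltrDl.
Qed.

Lemma le_supnorm (f : Cspace) x : `|f x| <= supnorm f.
Proof. by apply: (ub_le_sup (Cspace_bounded f)); exists x. Qed.

Lemma supnorm_le (f : Cspace) (M : R) :
  0 <= M -> (forall x, `|f x| <= M) -> supnorm f <= M.
Proof.
move=> M0 fM; rewrite /supnorm.
have [[x _]|noK] := pselect ([set: K] !=set0).
  by apply: ge_sup => [|t [y _ <-]]; [exists `|f x|, x|exact: fM].
rewrite (_ : [set _ | _ in _] = set0) ?sup0//.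
by rewrite -subset0 => t [x] _ _; apply: noK; exists x.
Qed.

Lemma supnorm_ge0 (f : Cspace) : 0 <= supnorm f.
Proof.
have [[x _]|noK] := pselect ([set: K] !=set0).
  exact: le_trans (le_supnorm f x).
rewrite /supnorm (_ : [set _ | _ in _] = set0) ?sup0//.
by rewrite -subset0 => t [x] _ _; apply: noK; exists x.
Qed.

Lemma ler_supnormD (f g : Cspace) : supnorm (f + g) <= supnorm f + supnorm g.
Proof.
apply: supnorm_le => [|x]; first by rewrite addr_ge0 ?supnorm_ge0.
by apply: le_trans (ler_normD (f x) (g x)) _; rewrite lerD ?le_supnorm.
Qed.

Lemma supnormZ_le (a : R) (f : Cspace) : supnorm (a *: f) <= `|a| * supnorm f.
Proof.
apply: supnorm_le => [|x]; first by rewrite mulr_ge0 ?supnorm_ge0.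
rewrite [leLHS](_ : _ = `|a * f x|)// normrM.
by rewrite ler_wpM2l ?le_supnorm.
Qed.

Lemma supnormZ (a : R) (f : Cspace) : supnorm (a *: f) = `|a| * supnorm f.
Proof.
apply/eqP; rewrite eq_le supnormZ_le/=.
have [->|a0] := eqVneq a 0; first by rewrite normr0 mul0r supnorm_ge0.
rewrite -ler_pdivlMl ?normr_gt0// -normfV.
by rewrite -{1}(scalerK a0 f); exact: supnormZ_le.
Qed.

Lemma supnorm_eq0 (f : Cspace) : supnorm f = 0 -> f = 0.
Proof.
move=> f0; apply: Cspace_eqP => x; apply/eqP.
by rewrite -normr_le0 -f0 le_supnorm.
Qed.

HB.instance Definition _ :=
  Lmodule_isNormed.Build R Cspace ler_supnormD supnormZ supnorm_eq0.

Lemma Cspace_normE (f : Cspace) : `|f| = supnorm f. Proof. by []. Qed.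

Lemma Cspace_cauchy_cvg (F : set_system Cspace) :
  ProperFilter F -> cauchy F -> cvg F.
Proof.
move=> FF Fc.
have Fball e : 0 < e -> exists f0 : Cspace, \forall f \near F, `|f0 - f| < e.
  by move=> e0; have [f0] := (cauchyP F).1 Fc e e0; exists f0.
have cvx x : cvg ((fun f : Cspace => f x) @ F).
  apply/cauchy_cvgP/cauchyP => e e0; have [f0 hf0] := Fball e e0.
  exists (f0 x); apply: filterS hf0 => f.
  by apply: le_lt_trans; exact: (le_supnorm (f0 - f) x).
pose g x := lim ((fun f : Cspace => f x) @ F).
have gnear e : 0 < e -> exists f0 : Cspace,
    (forall x, `|f0 x - g x| <= e) /\ \forall f \near F, `|f0 - f| < e.
  move=> e0; have [f0 hf0] := Fball e e0; exists f0; split => // x.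
  have h : (fun f : Cspace => `|f0 x - f x|) @ F --> `|f0 x - g x|.
    by apply: cvg_norm; apply: cvgB; [exact: cvg_cst|exact: cvx].
  rewrite -(cvg_lim _ h)//; apply: limr_le; first by apply/cvg_ex; eexists; exact: h.
  apply: filterS hf0 => f /ltW; apply: le_trans.
  exact: (le_supnorm (f0 - f) x).
have gc : continuous g.
  move=> x; apply/cvgrPdist_lt => e e0.
  have e3 : 0 < e / 3 by rewrite divr_gt0.
  have [f0 [f0g _]] := gnear _ e3.
  have /cvgrPdist_lt/(_ _ e3) := @Cspace_cts f0 x.
  apply: filterS => t ht.
  have -> : g x - g t = - (f0 x - g x) + ((f0 x - f0 t) + (f0 t - g t)).
    by ring.
  apply: le_lt_trans (ler_normD _ _) _; rewrite normrN.
  have -> : e = e / 3 + (e / 3 + e / 3) by field.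
  rewrite ler_ltD// (le_lt_trans (ler_normD _ _))// ltr_leD//.
pose G : Cspace := Cspace_Sub (mem_set gc : g \in cts_pred).
apply/cvg_ex; exists G; apply/cvgrPdist_lt => e e0.
have e2 : 0 < e / 2 by rewrite divr_gt0.
have e4 : 0 < e / 2 / 2 by rewrite divr_gt0.
have [f0 [f0g hf0]] := gnear _ e4.
apply: filterS hf0 => f hf.
have hG : `|G - f0| <= e / 2 / 2.
  apply: supnorm_le => [|x]; first exact: ltW.
  by rewrite [leLHS](_ : _ = `|g x - f0 x|)// distrC; exact: f0g.
rewrite -(subrK f0 G) -addrA (le_lt_trans (ler_normD _ _))//.
rewrite (lt_trans (ler_ltD hG hf))// -splitr ltr_pdivrMr// ltr_pMr//.
by rewrite ltr1n.
Qed.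

HB.instance Definition _ := Uniform_isComplete.Build Cspace Cspace_cauchy_cvg.

(* The topology of pointwise convergence on [D] is the initial topology for the
   restriction map into the product [R^D]. *)
Definition restrict_to (D : set K) (f : Cspace) : {ptws D -> R} :=
  fun x => f (set_val x).

Definition taup (D : set K) : topologicalType := 
  initial_topology (@restrict_to D).

Lemma taup_closed (D : set K) (Y : set Cspace) :
  closed (Y : set (taup D)) -> closed Y.
Proof.
have idc : continuous (id : Cspace -> taup D).
  apply: continuous_comp_initial => f.
  apply: (@pointwise_cvgP D R (@restrict_to D @ nbhs f) _ _).2 => x.
  apply/cvgrPdist_lt => e e0.
  apply: filterS (nbhsx_ballx f e e0) => h; apply: le_lt_trans.
  exact: (le_supnorm (f - h) (set_val x)).
by move=> Ycl; exact: (continuous_closedP _).1 idc Y Ycl.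
Qed.

End ContinuousFunctions.

Arguments Cspace : clear implicits.

Section ClosedSubspace.
Context (R : realType) (X : completeNormedModType R).

Record closedSubspace := ClosedSubspace {
  closedSubspace_set :> set X;
  closedSubspace_submod : submod_closed [in closedSubspace_set];
  closedSubspace_closed : closed closedSubspace_set
}.

Variable V : closedSubspace.

Definition csub_pred : {pred X} := [in closedSubspace_set V].

HB.instance Definition _ :=
  GRing.isSubmodClosed.Build R X csub_pred (closedSubspace_submod V).

Definition csub_type : Type := {x : X | x \in csub_pred}.

HB.instance Definition _ := SubChoice.on csub_type.
HB.instance Definition _ := [SubChoice_isSubLmodule of csub_type by <:].

Definition csub_norm (v : csub_type) : R := `|val v|.

Lemma ler_csub_normD (u v : csub_type) :
  csub_norm (u + v) <= csub_norm u + csub_norm v.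
Proof. exact: ler_normD. Qed.

Lemma csub_normZ (a : R) (v : csub_type) :
  csub_norm (a *: v) = `|a| * csub_norm v.
Proof. exact: normrZ. Qed.

Lemma csub_norm_eq0 (v : csub_type) : csub_norm v = 0 -> v = 0.
Proof. by move=> /normr0_eq0 v0; apply: val_inj. Qed.

HB.instance Definition _ :=
  Lmodule_isNormed.Build R csub_type ler_csub_normD csub_normZ csub_norm_eq0.

Lemma csub_cauchy_cvg (F : set_system csub_type) :
  ProperFilter F -> cauchy F -> cvg F.
Proof.
move=> FF Fc.
have : cvg (val @ F).
  apply/cauchy_cvgP/cauchyP => e e0; have [v hv] := (cauchyP F).1 Fc e e0.
  by exists (val v); rewrite -ball_normE; exact: hv.
move=> /cvg_ex[l hl].
have Vl : l \in csub_pred.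
  apply/mem_set; apply: (closed_cvg (closedSubspace_set V)) hl.
    exact: closedSubspace_closed.
  by apply: filterE => v; exact: set_mem (valP v).
apply/cvg_ex; exists (exist _ l Vl : csub_type).
apply/cvgrPdist_lt => e e0; have /cvgrPdist_lt/(_ e e0) := hl.
by apply: filterS.
Qed.

HB.instance Definition _ := Uniform_isComplete.Build csub_type csub_cauchy_cvg.

Definition csub_restr (f : X -> X) 
    (fV : forall x, closedSubspace_set V x -> closedSubspace_set V (f x)) :
  csub_type -> csub_type :=
  fun v => exist _ (f (val v)) (mem_set (fV _ (set_mem (valP v)))).

End ClosedSubspace.

Coercion csub_type : closedSubspace >-> Sortclass.

Section DirectedSets.
Context (d : Order.disp_t) (I : porderType d).

Definition up_directed := forall s t : I, exists u, (s <= u)%O /\ (t <= u)%O.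

Definition sigma_complete :=
  forall s : nat -> I, nondecreasing_seq s -> exists t, isLub (range s) t.

(* Convergence along this filter is convergence of nets indexed by [I]. *)
Definition tails : set_system I :=
  filter_from [set: I] (fun s => [set t | (s <= t)%O]).

End DirectedSets.

Arguments tails {d} I.

Section ProjectionalSkeleton.
Context (R : realType) (X : completeNormedModType R).

Definition separable_set (A : set X) :=
  exists C : set X, [/\ countable C, C `<=` A & A `<=` closure C].

Definition bounded_operator (f : X -> X) :=
  exists M : R, forall x, `|f x| <= M * `|x|.

(* On an operator that is not bounded this supremum takes a default value, so
   bounds on [opnorm] are only meaningful next to [bounded_operator]. *)
Definition opnorm (f : X -> X) : R :=
  sup [set `|f x| | x in [set x | `|x| <= 1]].

Record projectional_skeleton (d : Order.disp_t) (I : porderType d)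
    (P : I -> X -> X) : Prop := {
  ps_directed : up_directed I;
  ps_complete : sigma_complete I;
  ps_linear : forall s, linear (P s);
  ps_bounded : forall s, bounded_operator (P s);
  ps_proj : forall s, P s \o P s = P s;
  ps_separable : forall s, separable_set (range (P s));
  ps_cover : [set: X] = \bigcup_s range (P s);
  ps_comm : forall s t, (s <= t)%O -> P s = P s \o P t /\ P s = P t \o P s;
  ps_sup : forall (s : nat -> I) t, increasing_seq s -> isLub (range s) t ->
    range (P t) = closure (\bigcup_n range (P (s n)))
}.

Definition r_projectional_skeleton (r : R) (d : Order.disp_t)
    (I : porderType d) (P : I -> X -> X) : Prop :=
  [/\ 1 <= r, projectional_skeleton P & forall s, opnorm (P s) <= r].

End ProjectionalSkeleton.

Section RetractionalSkeleton.
Context (R : realType) (K : compactHausdorffType).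

(* Some metric on [A] induces the subspace topology of [A]; the values of [m]
   off [A] are irrelevant. *)
Definition metrizable_set (A : set K) := exists m : K -> K -> R,
  [/\ forall x y, A x -> A y -> 0 <= m x y,
      forall x y, A x -> A y -> (m x y = 0 <-> x = y),
      forall x y, A x -> A y -> m x y = m y x,
      forall x y z, A x -> A y -> A z -> m x z <= m x y + m y z
    & forall x (U : set K), A x ->
        (within A (nbhs x) U <->
         exists2 e : R, 0 < e & forall y, A y -> m x y < e -> U y)].

Record retractional_skeleton (d : Order.disp_t) (I : porderType d)
    (r : I -> K -> K) : Prop := {
  rs_directed : up_directed I;
  rs_complete : sigma_complete I;
  rs_continuous : forall s, continuous (r s);
  rs_retract : forall s, r s \o r s = r s;
  rs_metrizable : forall s, metrizable_set (range (r s));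
  rs_lim : forall x, r s x @[s --> tails I] --> x;
  rs_comm : forall s t, (s <= t)%O -> r s = r s \o r t /\ r s = r t \o r s;
  rs_sup : forall (s : nat -> I) t, increasing_seq s -> isLub (range s) t ->
    forall x, r (s n) x @[n --> \oo] --> r t x
}.

Definition has_retractional_skeleton := exists (d : Order.disp_t)
  (I : porderType d) (r : I -> K -> K), retractional_skeleton r.

Definition induced_by_retractional_skeleton (D : set K) :=
  exists (d : Order.disp_t) (I : porderType d) (r : I -> K -> K),
    retractional_skeleton r /\ D = \bigcup_s range (r s).

End RetractionalSkeleton.

(* Main.v *)
From HB Require Import structures.
Require Import Defs.
From mathcomp Require Import all_boot all_order all_algebra.
From mathcomp Require Import all_classical all_reals all_analysis.
From mathcomp Require Import ring lra.

(** Let [r] be a retractional skeleton inducing [D]. The projections are the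
    composition operators [P s f = f \o r s]; the work lies in choosing which
    indices [s] to keep.

    For every [f] the functions [f \o r s] converge uniformly: if [f] is
    constant on the common fibres of a directed family of maps, then, by
    compactness of [K * K], it oscillates arbitrarily little on the fibres of a
    single member ([small_oscillation]). Along an increasing sequence of indices
    with supremum [t] this gives [P (s n) f --> P t f] in norm ([comp_strong]);
    along the whole index set it gives an [s] with [P s f = f] ([comp_cover]).
    The range of [P s] is separable because the metric of the range of [r s]
    controls its members ([separable_range_comp]). With strong convergence in
    place of the density of ranges, the axioms of a 1-projectional skeleton pass
    to closed invariant subspaces ([strong_skeleton_subspace]).

    It remains to see that the indices preserving all the [Y n] are closed under
    suprema of sequences and cofinal. Closure is strong convergence together with
    the norm closedness of [Y n] ([preserves_sup]). Cofinality is a duality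
    argument ([preserves_cofinal]). A [taup D]-closed subspace is the set of
    functions killed by the finitely supported measures on [D] that annihilate
    it ([bipolar_taup]), so one has to show that [mu (P t f) = 0] when [mu] is
    such a measure for [Y n] and [f] is in [Y n]. Given [s], separability of the
    range of [P s] provides countably many annihilating measures that
    approximate, with control of the mass, all annihilating measures on that
    range; since their supports are countable subsets of [D], some index [t]
    above [s] fixes all of them ([countable_reflection]). Iterating and taking
    the supremum [t], every annihilating [mu] is approximated at [P t f] by
    annihilating measures [mu'] supported by fixed points of [r t], for which
    [mu' (P t f) = mu' f = 0]. *)

Import Order.TTheory GRing.Theory Num.Theory.
Import numFieldNormedType.Exports.

Local Open Scope classical_set_scope.
Local Open Scope ring_scope.

Set Implicit Arguments.
Unset Strict Implicit.
Unset Printing Implicit Defensive.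

(** * Countable choices and separability *)

(** The form in which separability is used throughout: members of [B] can be
    replaced by members of a countable part of [B] without changing which of
    countably many approximation properties they have. *)
Lemma countable_picks (Q : countType) T (rel : Q -> T -> Prop) (B : set T) :
  exists C : set T, [/\ countable C, C `<=` B &
    forall q b, B b -> rel q b -> exists2 c, C c & rel q c].
Proof.
have [B0|/set0P[b0 Bb0]] := eqVneq B set0.
  by exists set0; split => [|//|q b]; [exact: countable0|rewrite B0].
have /choice[f Hf] : forall q, exists c, B c /\ (forall b, B b -> rel q b -> rel q c).
  move=> q; have [[c [Bc qc]]|H] := pselect (exists c, B c /\ rel q c).
    by exists c.
  by exists b0; split=> // b Bb qb; case: H; exists b.
exists (range f); split.
- exact: card_le_trans (card_image_le _ _) (countableP _).
- by move=> _ [q _ <-]; have [] := Hf q.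
- by move=> q b Bb qb; exists (f q); [exists q|have [_ /(_ b)] := Hf q; exact].
Qed.

Section Separable.
Context (R : realType).

Lemma closure_normP (X : completeNormedModType R) (A : set X) x :
  closure A x <-> forall e, 0 < e -> exists2 a, A a & `|x - a| < e.
Proof.
split=> [cx e e0|H B /nbhs_ballP[e /= e0 eB]].
  by have [a [Aa]] := cx _ (nbhsx_ballx x e e0); rewrite -ball_normE; exists a.
by have [a Aa xa] := H e e0; exists a; split => //; apply: eB; rewrite -ball_normE.
Qed.

Lemma separable_setP (X : completeNormedModType R) (A : set X) :
  separable_set A <-> exists C : set X, [/\ countable C, C `<=` A &
    forall a e, A a -> 0 < e -> exists2 c, C c & `|a - c| < e].
Proof.
split=> -[C [Cc CA H]]; exists C; split=> //.
  by move=> a e /H/closure_normP; apply.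
by move=> a Aa; apply/closure_normP => e e0; exact: H.
Qed.

(** Used for projections restricted to a closed subspace, whose ranges sit
    isometrically inside the separable ranges of the original projections. *)
Lemma separable_isometry (X V : completeNormedModType R) (h : V -> X)
    (A : set X) (B : set V) :
    (forall u v, `|h u - h v| = `|u - v|) -> h @` B `<=` A ->
  separable_set A -> separable_set B.
Proof.
move=> hi BA /separable_setP[C0 [/countable_injP[j jinj] _ C0A]].
apply/separable_setP.
(* [j] numbers the dense set: [q] asks to be within [q.2.+1^-1] of its [q.1]-th
   point *)
have [C [Cc CB HC]] := countable_picks (Q := (nat * nat)%type)
  (fun q b => exists c, [/\ C0 c, j c = q.1 & `|h b - c| < q.2.+1%:R^-1]) B.
exists C; split => // b e Bb e0.
have [k] := ltr_add_invr (divr_gt0 e0 (ltr0n R 2)); rewrite add0r => ke.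
have [c C0c bc] : exists2 c, C0 c & `|h b - c| < k.+1%:R^-1.
  by apply: C0A => //; apply: BA; exists b.
have [b' Cb' [c' [C0c' /= jcc' b'c']]] := HC (j c, k) b Bb
  (ex_intro _ c (And3 C0c erefl bc)).
have E : c' = c by apply: jinj => //; apply/mem_set.
exists b' => //; rewrite -hi; rewrite E in b'c'.
rewrite (le_lt_trans (ler_distD c _ _))// (splitr e) (distrC c).
by rewrite ltrD// (lt_trans _ ke).
Qed.

(** * Strongly continuous families of projections *)

(** Norm-one projectional skeletons in a form that passes verbatim to closed
    invariant subspaces: the density condition on ranges is replaced by strong
    convergence along increasing sequences. *)
Record strong_skeleton (X : completeNormedModType R) (d : Order.disp_t)
    (I : porderType d) (P : I -> X -> X) : Prop := {
  ss_directed : up_directed I;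
  ss_complete : sigma_complete I;
  ss_linear : forall s, linear (P s);
  ss_contractive : forall s x, `|P s x| <= `|x|;
  ss_separable : forall s, separable_set (range (P s));
  ss_cover : forall x, exists s, P s x = x;
  ss_comm : forall s t x, (s <= t)%O -> P s (P t x) = P s x /\ P t (P s x) = P s x;
  ss_strong : forall (s : nat -> I) t, increasing_seq s -> isLub (range s) t ->
    forall x, P (s n) x @[n --> \oo] --> P t x
}.

(** The range of [P t] is the closure of the union of the ranges of the
    [P (s n)]: strong convergence gives one inclusion; for the other,
    [1 - P t] has norm at most 2 and kills that union. *)
Lemma strong_skeleton_1projectional (X : completeNormedModType R)
    (d : Order.disp_t) (I : porderType d) (P : I -> X -> X) :
  strong_skeleton P -> r_projectional_skeleton 1 P.
Proof.
move=> H.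
have Pid s x : P s (P s x) = P s x by have [] := ss_comm H x (lexx s).
have PB s x y : P s (x - y) = P s x - P s y.
  by rewrite addrC -scaleN1r (ss_linear H) scaleN1r addrC.
split=> //; last first.
  move=> s; apply: ge_sup.
    by exists `|P s 0|, 0 => //=; rewrite normr0 ler01.
  by move=> _ [x /= x1 <-]; exact: le_trans (ss_contractive H s x) x1.
split.
- exact: ss_directed H.
- exact: ss_complete H.
- exact: ss_linear H.
- by move=> s; exists 1 => x; rewrite mul1r (ss_contractive H).
- by move=> s; apply/funext => x /=.
- exact: ss_separable H.
- apply/seteqP; split => // x _; have [s sx] := ss_cover H x.
  by exists s => //; exists x.
- by move=> s t st; split; apply/funext => x /=; have [] := ss_comm H x st.
- move=> s t sinc st; apply/seteqP; split => x.
    move=> [y _ <-]; apply/closure_normP => e e0.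
    have /cvgrPdist_lt/(_ e e0)[N _ /(_ N)] := ss_strong H sinc st (x := y).
    by move=> /(_ (leqnn N)) sN; exists (P (s N) y) => //; exists N => //; exists y.
  move=> /closure_normP cx; exists x => //; apply/esym/eqP.
  rewrite -subr_eq0 -normr_le0; apply/ler_addgt0Pr => e e0; rewrite add0r.
  have [a [n _ [y _ <-]] xa] := cx _ (divr_gt0 e0 (ltr0n R 2)).
  have /(ss_comm H y)[_ tn] : (s n <= t)%O by apply: (proj1 st); exists n.
  have -> : x - P t x = (x - P (s n) y) - P t (x - P (s n) y).
    by rewrite PB tn opprB addrA subrK.
  rewrite (le_trans (ler_normB _ _))// (splitr e) lerD ?(ltW xa)//.
  exact: le_trans (ss_contractive H _ _) (ltW xa).
Qed.

Lemma strong_skeleton_subspace (X : completeNormedModType R)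
    (d : Order.disp_t) (I : porderType d) (P : I -> X -> X)
    (V : closedSubspace X)
    (PV : forall s x, closedSubspace_set V x -> closedSubspace_set V (P s x)) :
  strong_skeleton P -> strong_skeleton (fun s => csub_restr (PV s)).
Proof.
move=> H; split.
- exact: ss_directed H.
- exact: ss_complete H.
- by move=> s a u v; apply: val_inj; exact: (ss_linear H s a (val u) (val v)).
- by move=> s u; exact: (ss_contractive H s (val u)).
- move=> s; apply: (@separable_isometry X V val _ _ _ _ (ss_separable H s)).
    by move=> u v.
  by move=> _ [_ [u _ <-] <-]; exists (val u).
- move=> u; have [s su] := ss_cover H (val u).
  by exists s; apply: val_inj.
- move=> s t u st; have [st1 st2] := ss_comm H (val u) st.
  by split; apply: val_inj.
- move=> s t sinc st u; apply/cvgrPdist_lt => e e0.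
  have /cvgrPdist_lt/(_ e e0) := ss_strong H sinc st (x := val u).
  by apply: filterS.
Qed.

End Separable.

(** * Compactness and oscillation *)

Section Oscillation.
Context (R : realType) (K : compactHausdorffType).
Implicit Types (f g : Cspace R K).

Lemma tails_filter (d : Order.disp_t) (I : porderType d) (i0 : I) :
  up_directed I -> Filter (tails I).
Proof.
move=> Idir; apply: filter_from_filter; first by exists i0.
move=> i j _ _; have [k [ik jk]] := Idir i j; exists k => // l /= kl.
by split; [exact: le_trans ik kl|exact: le_trans jk kl].
Qed.

(** The pairs [(x, y)] with [r i x = r i y] and [`|f x - f y| >= e] form a
    decreasing family of closed subsets of the compact space [K * K], with empty
    intersection. *)
Lemma small_oscillation (d : Order.disp_t) (I : porderType d) (i0 : I)
    (r : I -> K -> K) f (e : R) :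
    up_directed I -> (forall i, continuous (r i)) ->
    (forall i j x y, (i <= j)%O -> r j x = r j y -> r i x = r i y) ->
    (forall x y, (forall i, r i x = r i y) -> f x = f y) ->
  0 < e -> exists i, forall x y, r i x = r i y -> `|f x - f y| < e.
Proof.
move=> Idir rc rle rf e0.
have TF := tails_filter i0 Idir.
have KK : compact ([set: K] `*` [set: K]) by apply: compact_setX; exact: compact_setT.
have := (compact_near_coveringP _).1 KK I (tails I)
  (fun i z => r i z.1 = r i z.2 -> `|f z.1 - f z.2| < e) TF.
case=> [[x y] _|i _ Hi]; last first.
  by exists i => x y; exact: (Hi i (lexx i) (x, y)).
have [fxy|/negP fxy] := boolP (`|f x - f y| < e).
  have H : `|f z.1 - f z.2| @[z --> (x, y)] --> `|f x - f y|.
    apply: cvg_norm; apply: cvgB.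
      by apply: (cvg_comp _ _ cvg_fst); exact: Cspace_cts.
    by apply: (cvg_comp _ _ cvg_snd); exact: Cspace_cts.
  exists ([set z | `|f z.1 - f z.2| < e], setT) => /=.
    by split; [exact: (cvgr_lt _ H)|exact: filterT].
  by move=> [z i] [].
have [i rxy] : exists i, r i x <> r i y.
  apply: contra_notP fxy => /forallNP H.
  by rewrite (rf x y) ?subrr ?normr0// => i; exact: contrapT.
have := @hausdorff_setT K; rewrite open_hausdorff => /(_ _ _ (introN eqP rxy)).
case=> -[A B] /= [/set_mem Ax /set_mem By] [Ao Bo /eqP AB0].
exists ([set z | A (r i z.1) /\ B (r i z.2)], [set j | (i <= j)%O]) => /=.
  split; last by exists i.
  exists (r i @^-1` A, r i @^-1` B) => //=.
  by split; apply: rc; apply: open_nbhs_nbhs; split.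
move=> [z j] /= [[Az Bz] ij] /(rle _ _ _ _ ij) E.
by have : set0 (r i z.1) by rewrite -AB0; split; rewrite // E.
Qed.

Section Separability.
Context (rho : K -> K -> R) (A : set (Cspace R K))
  (rho_nbhs : forall x e, 0 < e -> \forall y \near x, rho x y < e)
  (rho_triangle : forall x y z, rho x z <= rho x y + rho y z)
  (A_cts : forall f x e, A f -> 0 < e ->
     exists2 de, 0 < de & forall y, rho x y < de -> `|f x - f y| < e).

Lemma uniformly_continuous_rho f e : A f -> 0 < e ->
  exists n, forall x y, rho x y < n.+1%:R^-1 -> `|f x - f y| < e.
Proof.
move=> Af e0.
have := (compact_near_coveringP _).1 (@compact_setT K) nat \oo
  (fun n x => forall y, rho x y < n.+1%:R^-1 -> `|f x - f y| < e) _.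
case=> [x _|n _ Hn]; last by exists n => x y; exact: (Hn n (leqnn n) x).
have [de de0 Hde] := A_cts x Af (divr_gt0 e0 (ltr0n R 2)).
have de20 : 0 < de / 2 by rewrite divr_gt0.
exists ([set x' | rho x x' < de / 2], [set n | n.+1%:R^-1 < de / 2]) => /=.
  by split; [exact: rho_nbhs|exact: (near_infty_natSinv_lt (PosNum de20))].
move=> [x' n] /= [xx' nde] y x'y.
rewrite (le_lt_trans (ler_distD (f x) _ _))// (splitr e) distrC ltrD ?Hde//.
  by rewrite (lt_le_trans xx')// ler_pdivrMr// ler_pMr// ler1n.
by rewrite (le_lt_trans (rho_triangle x x' y))// (splitr de) ltrD// (lt_trans x'y).
Qed.

Lemma finite_net e : 0 < e ->
  exists L : seq K, forall x, exists2 c, c \in L & rho c x < e.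
Proof.
move=> e0.
pose F := filter_from [set: seq K] (fun L => [set L' : seq K | {subset L <= L'}]).
have FF : Filter F.
  apply: filter_from_filter; first by exists [::].
  move=> L1 L2 _ _; exists (L1 ++ L2) => // L /= L12.
  by split=> c cL; apply: L12; rewrite mem_cat cL ?orbT.
have := (compact_near_coveringP _).1 (@compact_setT K) (seq K) F
  (fun L x => exists2 c, c \in L & rho c x < e) FF.
case=> [x _|L _ HL]; last by exists L => x; exact: (HL L).
exists ([set x' | rho x x' < e], [set L : seq K | x \in L]) => /=.
  split; first exact: rho_nbhs.
  by exists [:: x] => // L /=; apply; rewrite mem_head.
by move=> [x' L] /= [xx' xL]; exists x.
Qed.

(** Members of [A] are uniformly continuous for [rho], so one that varies by less
    than [1 / k] on balls of radius [1 / n] is determined up to [4 / k] by rational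
    approximations of its values on a finite [1 / n]-net. There are countably
    many such data, and one member of [A] is picked for each. *)
Lemma separable_rho_continuous : separable_set A.
Proof.
have /choice[L HL] : forall n : nat, exists L : seq K,
    forall x, exists2 c, c \in L & rho c x < n.+1%:R^-1.
  by move=> n; apply: finite_net; rewrite invr_gt0.
apply/separable_setP.
(* [q = (n, k, vs)], where [vs] lists approximate values on the net [L n] *)
have [C [Cc CA HC]] := countable_picks (Q := (nat * nat * seq rat)%type)
  (fun q f => (forall x y, rho x y < q.1.1.+1%:R^-1 -> `|f x - f y| < q.1.2.+1%:R^-1)
    /\ forall c, c \in L q.1.1 ->
       `|f c - ratr (nth 0 q.2 (index c (L q.1.1)))| < q.1.2.+1%:R^-1) A.
exists C; split => // g e Ag e0.
have [k] := ltr_add_invr (divr_gt0 e0 (ltr0n R 5)); rewrite add0r => ke.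
have k0 : 0 < k.+1%:R^-1 :> R by rewrite invr_gt0.
have [n Hn] := uniformly_continuous_rho Ag k0.
have /choice[q Hq] : forall c, exists q : rat, `|g c - ratr q| < k.+1%:R^-1.
  move=> c; have [|q] := @rat_in_itvoo R (g c) (g c + k.+1%:R^-1).
    by rewrite ltrDl.
  rewrite in_itv/= => /andP[q1 q2]; exists q.
  by rewrite distrC ger0_norm ?subr_ge0 ?(ltW q1)// ltrBlDl.
have nthq c : c \in L n -> nth 0 (map q (L n)) (index c (L n)) = q c.
  by move=> cL; rewrite (nth_map c) ?index_mem// nth_index.
have [|f Cf [/= f1 f2]] := HC (n, k, map q (L n)) g Ag.
  split; first exact: Hn.
  by move=> c /= cL; rewrite nthq//; exact: Hq.
exists f => //; apply: (@le_lt_trans _ _ (4 * k.+1%:R^-1)); last first.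
  apply: (@lt_trans _ _ (4 * (e / 5))); first by rewrite ltr_pM2l.
  by rewrite mulrCA gtr_pMr// ltr_pdivrMr// mul1r ltr_nat.
apply: supnorm_le => [|x]; first by rewrite mulr_ge0 ?ltW.
have [c cL cx] := HL n x.
rewrite [leLHS](_ : _ = `|g x - f x|)//.
have := f2 c cL; rewrite nthq// => {}f2.
have -> : 4 * k.+1%:R^-1 =
    k.+1%:R^-1 + (k.+1%:R^-1 + (k.+1%:R^-1 + k.+1%:R^-1)) :> R.
  by move: k.+1%:R^-1 => de; lra.
rewrite (le_trans (ler_distD (g c) _ _))// lerD//.
  by rewrite distrC; apply: ltW; exact: Hn.
rewrite (le_trans (ler_distD (ratr (q c)) _ _))// lerD//; first exact: ltW.
rewrite (le_trans (ler_distD (f c) _ _))// lerD//.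
  by rewrite distrC; exact: ltW.
by apply: ltW; exact: f1.
Qed.

End Separability.

(** * Composition operators *)

Lemma comp_cts_pred (r : K -> K) f : continuous r -> f \o r \in @cts_pred R K.
Proof.
move=> rc; apply/mem_set => x.
by apply: continuous_comp; [exact: rc|exact: Cspace_cts].
Qed.

Definition Cspace_comp (r : K -> K) (rc : continuous r) f : Cspace R K :=
  Cspace_Sub (comp_cts_pred f rc).

Lemma Cspace_compE (r : K -> K) (rc : continuous r) f x :
  Cspace_comp rc f x = f (r x).
Proof. by []. Qed.

Lemma separable_range_comp (r : K -> K) (rc : continuous r) :
  metrizable_set R (range r) -> separable_set (range (Cspace_comp rc)).
Proof.
case=> m [_ _ _ mD mN].
have rr x : range r (r x) by exists x.
apply: (separable_rho_continuous (rho := fun x y => m (r x) (r y))).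
- move=> x e e0; have /mN H : range r (r x) by [].
  have /H : exists2 e', 0 < e' &
      forall y, range r y -> m (r x) y < e' -> [set y | m (r x) y < e] y.
    by exists e.
  move=> /(rc x) near_rx.
  by apply: (filterS (P := r @^-1` (fun y => range r y -> m (r x) y < e))) => // y; exact.
- by move=> x y z; exact: mD _ _ _ (rr x) (rr y) (rr z).
- move=> _ x e [f _ <-] e0; have /mN H : range r (r x) by [].
  have [|de de0 Hde] := (H [set y | `|f (r x) - f y| < e]).1.
    have /cvgrPdist_lt/(_ e e0) := @Cspace_cts R K f (r x).
    by apply: filterS.
  by exists de => // y; exact: Hde.
Qed.

End Oscillation.

(** * Annihilating measures *)

Section Annihilators.
Context (R : realType) (K : compactHausdorffType).
Implicit Types (f g : Cspace R K) (mu : seq (R * K)).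

Lemma CspaceBZE f g a x : Cspace_fun (f - a *: g) x = f x - a * g x.
Proof. by []. Qed.

(** A sequence of weighted points stands for the finitely supported measure
    that is the corresponding combination of Dirac masses. *)
Definition pairing mu f : R := \sum_(m <- mu) m.1 * f m.2.

Definition mass mu : R := \sum_(m <- mu) `|m.1|.

Definition supported (D : set K) mu := forall m, m \in mu -> D m.2.

Definition annihilates mu (Y : set (Cspace R K)) :=
  forall f, Y f -> pairing mu f = 0.

Lemma pairingB mu f g : pairing mu (f - g) = pairing mu f - pairing mu g.
Proof. by rewrite /pairing -sumrB; apply: eq_bigr => m _; rewrite -mulrBr. Qed.

Lemma pairingBZ mu f g a : pairing mu (f - a *: g) = pairing mu f - a * pairing mu g.
Proof.
rewrite pairingB; congr (_ - _).
by rewrite mulr_sumr; apply: eq_bigr => m _; rewrite mulrCA.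
Qed.

Lemma eq_pairing mu f g :
  supported [set x | f x = g x] mu -> pairing mu f = pairing mu g.
Proof. by move=> fg; apply: eq_big_seq => m /fg /= ->. Qed.

Lemma mass_ge0 mu : 0 <= mass mu.
Proof. exact: sumr_ge0. Qed.

Lemma le_pairing mu f : `|pairing mu f| <= mass mu * `|f|.
Proof.
rewrite /mass mulr_suml; apply: (le_trans (ler_norm_sum _ _ _)).
by apply: ler_sum => m _; rewrite normrM ler_wpM2l//; exact: le_supnorm.
Qed.

Lemma submodP (Y : set (Cspace R K)) : submod_closed [in Y] ->
  [/\ Y 0, forall a f, Y f -> Y (a *: f) &
      forall a f g, Y f -> Y g -> Y (f - a *: g)].
Proof.
case=> Y0 YD; split; first exact: set_mem.
  move=> a f Yf; apply: set_mem; rewrite -[_ *: _]addr0.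
  by apply: YD; [exact: mem_set|].
move=> a f g Yf Yg; apply: set_mem; rewrite addrC -scaleNr.
by apply: YD; exact: mem_set.
Qed.

(** Finite-dimensional duality, by induction on the points. When a point [p] is
    added, either [Y] vanishes at [p], or it contains [y0] with [y0 p = 1] and the
    induction hypothesis applies to [g - g p *: y0] and the members of [Y] that
    vanish at [p]. *)
Lemma annihilator_interpolation (Y : set (Cspace R K)) (ps : seq K) g :
    submod_closed [in Y] ->
    (forall mu, supported [set` ps] mu -> annihilates mu Y -> pairing mu g = 0) ->
  exists2 y, Y y & forall p, p \in ps -> y p = g p.
Proof.
elim: ps Y g => [|p ps IH] Y g Ysub; have [Y0 YZ YB] := submodP Ysub => H.
  by exists 0.
have [Yp|/existsNP[y1 /not_implyP[Yy1 y1p]]] := pselect (forall y, Y y -> y p = 0).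
  have gp : g p = 0.
    have := H [:: (1, p)]; rewrite /pairing big_seq1 mul1r; apply.
      by move=> m; rewrite inE => /eqP -> /=; exact: mem_head.
    by move=> y /Yp yp; rewrite /pairing big_seq1 mul1r.
  have [mu mups|y Yy yg] := IH Y g Ysub; last first.
    exists y => // q; rewrite inE => /orP[/eqP ->|/yg//].
    by rewrite gp Yp.
  by apply: H => m /mups /= mps; rewrite inE mps orbT.
have [y0 Yy0 y0p] : exists2 y0, Y y0 & y0 p = 1.
  exists ((y1 p)^-1 *: y1); first exact: YZ.
  by rewrite [LHS](_ : _ = (y1 p)^-1 * y1 p)// mulVf//; apply/eqP.
pose Y' := [set y | Y y /\ y p = 0].
have Y'sub : submod_closed [in Y'].
  split; first by apply/mem_set.
  move=> a y z /set_mem[Yy yp] /set_mem[Yz zp]; apply/mem_set.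
  rewrite addrC -[a]opprK scaleNr; split; first exact: YB.
  by apply: (etrans (CspaceBZE z y (- a) p)); rewrite yp zp mulr0 subr0.
have [mu mups muY'|y [Yy yp] yg] := IH Y' (g - g p *: y0) Y'sub; last first.
  exists (y - (- g p) *: y0); first exact: YB.
  move=> q; rewrite inE => /orP[/eqP ->|/yg].
    by rewrite CspaceBZE yp y0p mulr1 opprK add0r.
  by rewrite !CspaceBZE => ->; rewrite mulNr opprK subrK.
(* the measure [mu - mu(y0) delta_p] annihilates [Y] *)
have pair_cons f : pairing ((- pairing mu y0, p) :: mu) f =
    pairing mu (f - f p *: y0).
  by rewrite pairingBZ {1}/pairing big_cons/= mulNr addrC mulrC.
rewrite -pair_cons; apply: H.
  move=> m; rewrite inE => /orP[/eqP ->|/mups /= mps]; first exact: mem_head.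
  by rewrite /= inE mps orbT.
move=> y Yy; rewrite pair_cons; apply: muY'; split; first exact: YB.
by rewrite CspaceBZE y0p mulr1 subrr.
Qed.

(** Interpolating [g] on larger and larger finite subsets of [D] produces a
    filter on [Y] that converges to [g] pointwise on [D]. *)
Lemma bipolar_taup (D : set K) (Y : set (Cspace R K)) g :
    submod_closed [in Y] -> closed (Y : set (taup R D)) ->
    (forall mu, supported D mu -> annihilates mu Y -> pairing mu g = 0) ->
  Y g.
Proof.
move=> Ysub Ycl H.
pose B (ps : seq K) : set (Cspace R K) :=
  [set y | Y y /\ forall p, p \in ps -> y p = g p].
pose F := filter_from [set ps : seq K | forall p, p \in ps -> D p] B.
have FP : ProperFilter F.
  apply: filter_from_proper; last first.
    move=> ps psD; have [mu mups muY|y Yy yg] :=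
      annihilator_interpolation (ps := ps) (g := g) Ysub; last first.
      by exists y; split => //; exact: yg.
    by apply: H => // m /mups /= /psD.
  apply: filter_from_filter; first by exists [::].
  move=> ps qs psD qsD; exists (ps ++ qs) => [p|y [Yy yg]].
    by rewrite mem_cat => /orP[/psD|/qsD].
  by split; split => // p pp; apply: yg; rewrite mem_cat pp ?orbT.
have Fg : F --> (g : taup R D).
  have FW : restrict_to (D := D) y @[y --> F] --> restrict_to (D := D) g.
    apply/pointwise_cvgP => x; apply: cvg_near_cst.
    exists [:: set_val x] => [p|y [_ yg]].
      by rewrite inE => /eqP ->; exact: set_valP.
    by apply: yg; exact: mem_head.
  move=> U [_ [[W Wo <-] Wg WU]].
  by apply: (filterS WU); apply: FW; exact: open_nbhs_nbhs.
have FY : F Y by exists [::] => // y [].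
apply: Ycl => U /Fg FU.
by have [y [Uy Yy]] := filter_ex (filterI FU FY); exists y.
Qed.

End Annihilators.

(** * Directed sigma-complete orders *)

Section SubIndex.
Context (d : Order.disp_t) (I : porderType d) (p : pred I).

Definition sub_index : Type := {s : I | p s}.

HB.instance Definition _ := SubChoice.on sub_index.
HB.instance Definition _ := [SubChoice_isSubPOrder of sub_index by <: with d].

Lemma le_sub_index (s t : sub_index) : (s <= t)%O = (val s <= val t)%O.
Proof. by []. Qed.

Lemma isLub_val (s : nat -> sub_index) t u :
    p u -> isLub (range (val \o s)) u -> isLub (range s) t -> val t = u.
Proof.
move=> pu [us uleast] [ts tleast]; apply/eqP; rewrite eq_le; apply/andP; split.
  apply: (tleast (exist _ u pu)) => _ [n _ <-].
  by rewrite le_sub_index; apply: us; exists n.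
by apply: uleast => _ [n _ <-]; rewrite -le_sub_index; apply: ts; exists n.
Qed.

End SubIndex.

Lemma countable_upper_bound (d : Order.disp_t) (I : porderType d) T
    (A : set T) (u : T -> I) (s : I) :
    up_directed I -> sigma_complete I -> countable A ->
  exists t, (s <= t)%O /\ forall a, A a -> (u a <= t)%O.
Proof.
move=> Idir Icomp /countable_injP[j jinj].
have /choice[v Hv] : forall n, exists i, forall a, A a -> j a = n -> u a = i.
  move=> n; have [[a [Aa jan]]|H] := pselect (exists a, A a /\ j a = n).
    by exists (u a) => b Ab jbn; congr u; apply: jinj; rewrite ?jbn//; exact: mem_set.
  by exists s => a Aa jan; case: H; exists a.
have /choice[ub Hub] : forall st : I * I, exists t, (st.1 <= t)%O /\ (st.2 <= t)%O.
  by move=> [a b]; exact: Idir.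
pose w := fix w n := if n is n'.+1 then ub (w n', v n') else s.
have /Icomp[t [wt _]] : nondecreasing_seq w.
  by apply/nondecreasing_seqP => n; have [] := Hub (w n, v n).
exists t; split; first by apply: wt; exists 0%N.
move=> a Aa; rewrite (Hv _ a Aa erefl).
have [_ /= /le_trans] := Hub (w (j a), v (j a)); apply.
by apply: wt; exists (j a).+1.
Qed.

(** * Composition with the retractions of a skeleton *)

Section Retractional.
Context (R : realType) (K : compactHausdorffType) (d : Order.disp_t)
  (I : porderType d) (r : I -> K -> K) (rsk : retractional_skeleton R r) (i0 : I).
Implicit Types (f g : Cspace R K).

Lemma retract_continuous s : continuous (r s).
Proof. exact: rs_continuous rsk s. Qed.

Let P s : Cspace R K -> Cspace R K := Cspace_comp (@retract_continuous s).

Lemma retract_comp s t x : (s <= t)%O -> r s (r t x) = r s x /\ r t (r s x) = r s x.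
Proof.
by move=> /(rs_comm rsk)[st ts]; split; [rewrite {2}st|rewrite {2}ts].
Qed.

Lemma retract_ker s t x y : (s <= t)%O -> r t x = r t y -> r s x = r s y.
Proof.
move=> st E; have [<- _] := retract_comp x st.
by have [<- _] := retract_comp y st; rewrite E.
Qed.

(** The axiom on suprema speaks of strictly increasing sequences only; a
    nondecreasing one is eventually constant or has a strictly increasing
    subsequence with the same supremum. *)
Lemma retract_sup_ker (s : nat -> I) t x y :
    nondecreasing_seq s -> isLub (range s) t ->
  (forall n, r (s n) x = r (s n) y) -> r t x = r t y.
Proof.
move=> snd [st tleast] sxy.
have [[N HN]|/forallNP H] := pselect (exists N, forall m, (N <= m)%N -> s m = s N).
  suff -> : t = s N by exact: sxy.
  apply/eqP; rewrite eq_le; apply/andP; split; last by apply: st; exists N.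
  apply: tleast => _ [n _ <-]; rewrite -(HN (maxn n N)) ?leq_maxr//.
  by apply: snd; exact: leq_maxl.
have /choice[next Hnext] : forall N, exists m, (N <= m)%N /\ (s N < s m)%O.
  move=> N; have /existsNP[m /not_implyP[Nm smN]] := H N.
  by exists m; split => //; rewrite lt_neqAle snd// eq_sym andbT; apply/eqP.
pose tau k := iter k next 0%N.
have tau_ge k : (k <= tau k)%N.
  elim: k => // k IH; apply: leq_ltn_trans IH _ => /=.
  have [+ lt] := Hnext (tau k); rewrite leq_eqVlt => /orP[/eqP E|//].
  by move: lt; rewrite -E ltxx.
have tau_inc : increasing_seq (s \o tau).
  by apply/increasing_seqP => k; have [] := Hnext (tau k).
have tau_lub : isLub (range (s \o tau)) t.
  split=> [_ [k _ <-]|b bs]; first by apply: st; exists (tau k).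
  apply: tleast => _ [n _ <-]; apply: (@le_trans _ _ (s (tau n))).
    by apply: snd; exact: tau_ge.
  by apply: bs; exists n.
have Hx := rs_sup rsk tau_inc tau_lub (x := x).
have Hy := rs_sup rsk tau_inc tau_lub (x := y).
apply: (cvg_unique (@hausdorff_setT K) Hx).
by rewrite (_ : (fun n => _) = (fun n => r ((s \o tau) n) y))//; apply/funext => n /=.
Qed.

(** The norm convergence of [f \o r (s n)] comes from compactness alone: past
    some [n], [f \o r t] oscillates by less than [e] on the fibres of [r (s n)],
    and [r t x] and [r (s n) x] lie in one fibre. *)
Lemma comp_strong (s : nat -> I) t f e :
    nondecreasing_seq s -> isLub (range s) t -> 0 < e ->
  exists N, forall n, (N <= n)%N -> `|P t f - P (s n) f| <= e.
Proof.
move=> snd st e0.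
have [] := @small_oscillation R K _ nat 0%N (r \o s) (P t f) e.
- by move=> m n; exists (maxn m n); rewrite !leEnat leq_maxl leq_maxr.
- by move=> n; exact: retract_continuous.
- by move=> m n x y mn; apply: retract_ker; exact: snd.
- by move=> x y xy; congr (f _); exact: retract_sup_ker xy.
- exact: e0.
move=> N HN; exists N => n Nn; apply: supnorm_le => [|x]; first exact: ltW.
have snt : (s n <= t)%O by apply: (proj1 st); exists n.
have sNn : (s N <= s n)%O by exact: snd.
have [tx1 tx2] := retract_comp x snt.
rewrite [leLHS](_ : _ = `|P t f x - P t f (r (s n) x)|); last first.
  by rewrite !Cspace_compE tx2.
apply/ltW/HN => /=.
by have [-> _] := retract_comp x sNn.
Qed.

(** By [small_oscillation] some [i n] makes [f] oscillate by less than
    [n.+1^-1] on the fibres of [r (i n)]; an upper bound [t] of the [i n] then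
    makes [f] constant on the fibres of [r t], and [x] and [r t x] share one. *)
Lemma comp_cover f : exists s, P s f = f.
Proof.
have osc n : exists i, forall x y, r i x = r i y -> `|f x - f y| < n.+1%:R^-1.
  apply: (small_oscillation i0).
  - exact: rs_directed rsk.
  - exact: retract_continuous.
  - by move=> i j x y; exact: retract_ker.
  - move=> x y xy; congr (f _).
    have TP : ProperFilter (tails I).
      apply: filter_from_proper; first exact: (tails_filter i0 (rs_directed rsk)).
      by move=> i _; exists i => /=.
    apply: (cvg_unique (@hausdorff_setT K) (rs_lim rsk (x := x))).
    by rewrite (_ : (fun s => _) = (fun s => r s y)); [exact: (rs_lim rsk)|exact/funext].
  - by rewrite invr_gt0.
have /choice[i Hi] := osc.
have [t [_ it]] := countable_upper_bound i i0 (rs_directed rsk) (rs_complete rsk)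
  (countableP [set: nat]).
exists t; apply: Cspace_eqP => x; rewrite Cspace_compE.
apply/eqP; rewrite -subr_eq0 -normr_le0; apply/ler_addgt0Pr => e e0; rewrite add0r.
have [n] := ltr_add_invr e0; rewrite add0r => /ltW; apply: le_trans.
apply/ltW/Hi; apply: (@retract_ker _ t); first exact: it.
by have [] := retract_comp x (lexx t).
Qed.

Lemma comp_contractive s f : `|P s f| <= `|f|.
Proof.
by apply: supnorm_le => [|x]; [exact: supnorm_ge0|exact: (le_supnorm f (r s x))].
Qed.

Lemma comp_comm s t f : (s <= t)%O -> P s (P t f) = P s f /\ P t (P s f) = P s f.
Proof.
move=> st; split; apply: Cspace_eqP => x; rewrite !Cspace_compE.
  by have [_ ->] := retract_comp x st.
by have [-> _] := retract_comp x st.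
Qed.

(** The tolerance [de = e / (2 * N.+1)] allows, within a total error [e], for
    replacing twice a function by one at distance [de] under a measure of mass
    at most [N], and for two further errors [de] in the values themselves. *)
Lemma error_budget (F : realFieldType) (e : F) (N : nat) :
  e = N%:R * (e / (2 * N.+1%:R)) +
      (e / (2 * N.+1%:R) + (e / (2 * N.+1%:R) + N%:R * (e / (2 * N.+1%:R)))).
Proof. by field; rewrite -[1]/(1%:R) -natrD. Qed.

(** * Cofinality of the indices that preserve the subspaces *)

Context (Y : nat -> set (Cspace R K)).
Let D := \bigcup_s range (r s).

Definition preserves s := forall n f, Y n f -> Y n (P s f).

Lemma supported_fixed (mu : seq (R * K)) : supported D mu ->
  exists t, supported [set x | r t x = x] mu.
Proof.
elim: mu => [|m mu IH] Dm; first by exists i0.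
have [|t Ht] := IH; first by move=> m' m'mu; apply: Dm; rewrite inE m'mu orbT.
have [u _ [x _ xm]] := Dm m (mem_head _ _).
have [v [tv uv]] := rs_directed rsk t u.
exists v => m'; rewrite inE => /orP[/eqP ->|/Ht /= <-].
  by rewrite /= -xm; have [] := retract_comp x uv.
by have [] := retract_comp m'.2 tv.
Qed.

(** Among the annihilating measures of mass at most [N], countably many suffice
    to approximate all of them on the separable range of [P s]. Each of those is
    supported by the fixed points of some retraction, and [t] bounds the
    corresponding indices. *)
Lemma countable_reflection s : exists t, (s <= t)%O /\
  forall n (mu : seq (R * K)) (N : nat) g e, supported D mu -> annihilates mu (Y n) ->
    mass mu <= N%:R -> P s g = g -> 0 < e ->
  exists mu', [/\ annihilates mu' (Y n), mass mu' <= N%:R,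
    `|pairing mu g - pairing mu' g| < e & supported [set x | r t x = x] mu'].
Proof.
have /separable_setP[G [/countable_injP[j jinj] _ Gdense]] :=
  separable_range_comp (@retract_continuous s) (rs_metrizable rsk s).
pose B := [set c : nat * nat * seq (R * K) | [/\ supported D c.2,
  annihilates c.2 (Y c.1.1) & mass c.2 <= c.1.2%:R]].
(* [q = (n, N, i, v, k)] asks for a measure annihilating [Y n], of mass at most
   [N], with value within [k.+1^-1] of [v] at the [i]-th dense function *)
have [C [Cc CB HC]] := countable_picks (Q := (nat * nat * nat * rat * nat)%type)
  (fun q c => c.1 = q.1.1.1 /\ exists g, [/\ G g, j g = q.1.1.2 &
     `|pairing c.2 g - ratr q.1.2| < q.2.+1%:R^-1]) B.
have /choice[u Hu] : forall c, exists t, B c -> supported [set x | r t x = x] c.2.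
  move=> c; have [[/supported_fixed[t Ht] _ _]|nB] := pselect (B c).
    by exists t.
  by exists i0.
have [t [st ut]] := countable_upper_bound u s (rs_directed rsk) (rs_complete rsk) Cc.
exists t; split=> // n mu N g e Dmu muY muN sg e0.
pose de := e / (2 * N.+1%:R).
have de0 : 0 < de by rewrite divr_gt0// mulr_gt0.
have [|g0 Gg0 gg0] := Gdense g de _ de0; first by exists g.
have [k] := ltr_add_invr de0; rewrite add0r => kde.
have [q] := @rat_in_itvoo R (pairing mu g0) (pairing mu g0 + k.+1%:R^-1)
  ltac:(by rewrite ltrDl invr_gt0).
rewrite in_itv/= => /andP[q1 q2].
have muq : `|pairing mu g0 - ratr q| < k.+1%:R^-1.
  by rewrite distrC ger0_norm ?subr_ge0 ?(ltW q1)// ltrBlDl.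
have [|[[n' N'] mu'] Cc' [/= [En EN] [g1 [Gg1 jg1 g1q]]]] :=
  HC (n, N, j g0, q, k) (n, N, mu) (And3 Dmu muY muN).
  by split => //=; exists g0.
subst n' N'; have Eg : g1 = g0 by apply: jinj => //; exact/mem_set.
rewrite {}Eg {jg1 Gg1} in g1q.
have [/= Dmu' muY' muN'] := CB _ Cc'.
exists mu'; split => //; last first.
  move=> m /(Hu _ (CB _ Cc')) /= <-.
  by have [] := retract_comp m.2 (ut _ Cc').
have close (nu : seq (R * K)) : mass nu <= N%:R ->
    `|pairing nu g - pairing nu g0| <= N%:R * de.
  move=> nuN; rewrite -pairingB (le_trans (le_pairing _ _))//.
  by apply: ler_pM => //; [exact: mass_ge0|exact: ltW].
rewrite (error_budget e N) -/de.
rewrite (le_lt_trans (ler_distD (pairing mu g0) _ _))// ler_ltD ?close//.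
rewrite (le_lt_trans (ler_distD (ratr q) _ _))// ltr_leD ?(lt_trans muq)//.
rewrite (le_trans (ler_distD (pairing mu' g0) _ _))// lerD//.
  by rewrite distrC ltW// (lt_trans g1q).
by rewrite distrC close.
Qed.

(** Let [t] be the supremum of a sequence in which each [s n.+1] reflects [s n].
    If [mu] annihilates [Y n] and [f] is in [Y n], then [mu] is approximated on
    [P (s m) f], hence on [P t f], by annihilating measures of bounded mass that
    live on the fixed points of [r t]; these vanish at [P t f] because they do
    not distinguish it from [f]. *)
Lemma preserves_cofinal s0 :
    (forall n, submod_closed [in Y n]) ->
    (forall n, closed (Y n : set (taup R D))) ->
  exists t, (s0 <= t)%O /\ preserves t.
Proof.
move=> Ysub Ycl; have /choice[next Hnext] := countable_reflection.
pose s n := iter n next s0.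
have snd : nondecreasing_seq s.
  by apply/nondecreasing_seqP => n; have [] := Hnext (s n).
have [t st] := rs_complete rsk snd.
exists t; split; first by apply: (proj1 st); exists 0%N.
move=> n f Yf; apply: (bipolar_taup (D := D) (Ysub n) (Ycl n)) => mu Dmu muY.
have [N muN] : exists N : nat, mass mu <= N%:R.
  have /archi_boundP/ltW muN := mass_ge0 mu.
  by exists (Num.Def.archi_bound (mass mu)).
apply/eqP; rewrite -normr_le0; apply/ler_addgt0Pr => e e0; rewrite add0r.
pose de := e / (2 * N.+1%:R).
have de0 : 0 < de by rewrite divr_gt0// mulr_gt0.
have [m /(_ m (leqnn m)) tm] := comp_strong f snd st de0.
have [mu' [muY' muN' mumu' mu'fix]] := (Hnext (s m)).2 n mu N (P (s m) f) de
  Dmu muY muN (proj1 (comp_comm f (lexx _))) de0.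
have mu't : pairing mu' (P t f) = 0.
  rewrite -(muY' f Yf); apply: eq_pairing => p /mu'fix /= <-.
  have smt : (s m.+1 <= t)%O by apply: (proj1 st); exists m.+1.
  by congr (f _); have [_] := retract_comp p.2 smt.
have close (nu : seq (R * K)) : mass nu <= N%:R ->
    `|pairing nu (P t f) - pairing nu (P (s m) f)| <= N%:R * de.
  move=> nuN; rewrite -pairingB (le_trans (le_pairing _ _))//.
  by apply: ler_pM => //; exact: mass_ge0.
have := close _ muN'; rewrite mu't sub0r normrN => mu'g.
rewrite (error_budget e N) -/de -[X in `|X|]subr0.
rewrite (le_trans (ler_distD (pairing mu (P (s m) f)) _ _))// lerD ?close//.
rewrite (le_trans (ler_distD (pairing mu' (P (s m) f)) _ _))// lerD//; first exact: ltW.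
by rewrite subr0 (le_trans mu'g)// lerDr ltW.
Qed.

End Retractional.

(** A point of [K] forces the index set to be inhabited, since [r s x] converges
    to [x] along its tails. On the empty space any constant family of identities
    is a skeleton, and [bool] serves as its index set. *)
Lemma inhabited_skeleton (R : realType) (K : compactHausdorffType) (D : set K) :
    induced_by_retractional_skeleton R D ->
  exists (d : Order.disp_t) (I : porderType d) (r : I -> K -> K) (i0 : I),
    retractional_skeleton R r /\ D = \bigcup_s range (r s).
Proof.
case=> d [I [r [rsk DE]]].
have [[x _]|K0] := pselect ([set: K] !=set0).
  have [i0 _ _] : tails I (r ^~ x @^-1` setT) by apply: (rs_lim rsk); exact: filterT.
  by exists d, I, r, i0.
have noK (x : K) : False by apply: K0; exists x.
exists Order.BoolOrder.bool_display, bool, (fun _ => id), true; split; last first.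
  by apply/seteqP; split => x; case: (noK x).
split.
- by move=> a b; exists true; rewrite !lex1.
- move=> s _; have [[n sn]|/forallNP sF] := pselect (exists n, s n).
    by exists true; split => [b _|b]; [exact: lex1|apply; exists n].
  exists false; split => [_ [n _ <-]|b _]; last exact: le0x.
  by move/negP/negbTE: (sF n) => ->.
- by move=> _ x.
- by [].
- by move=> _; exists (fun _ _ => 0); split => x; case: (noK x).
- by move=> x; case: (noK x).
- by [].
- by move=> s t _ _ x; case: (noK x).
Qed.

(** * The skeleton of preserving indices *)

Section PreservingIndices.
Context (R : realType) (K : compactHausdorffType) (d : Order.disp_t)
  (I : porderType d) (r : I -> K -> K) (rsk : retractional_skeleton R r) (i0 : I)
  (Y : nat -> set (Cspace R K))
  (Ysub : forall n, submod_closed [in Y n])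
  (Ycl : forall n, closed (Y n : set (taup R (\bigcup_s range (r s))))).

Let P s : Cspace R K -> Cspace R K := Cspace_comp (retract_continuous rsk (s := s)).

Lemma preserves_sup (s : nat -> I) t :
    nondecreasing_seq s -> isLub (range s) t ->
  (forall n, preserves rsk Y (s n)) -> preserves rsk Y t.
Proof.
move=> snd st sY n f Yf; apply: (taup_closed (Ycl (n := n))).
apply/closure_normP => e e0.
have [N /(_ N (leqnn N)) HN] := comp_strong rsk f snd st (divr_gt0 e0 (ltr0n R 2)).
exists (P (s N) f); first exact: sY.
by rewrite (le_lt_trans HN)// ltr_pdivrMr// ltr_pMr// ltr1n.
Qed.

Let p : pred I := fun s => `[< preserves rsk Y s >].

(** Cofinality of the preserving indices carries directedness and covering over
    from the full index set; their closure under suprema carries the rest. *)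
Lemma preserving_strong_skeleton :
  strong_skeleton (fun s : sub_index p => P (val s)).
Proof.
have cofinal s : exists t : sub_index p, (s <= val t)%O.
  have [t [st tY]] := preserves_cofinal rsk i0 s Ysub Ycl.
  by exists (exist _ t (introT (asboolP _) tY)).
have Icomp (s : nat -> sub_index p) : nondecreasing_seq s ->
    exists2 t, p t & isLub (range (val \o s)) t.
  move=> snd; have snd' : nondecreasing_seq (val \o s) by move=> m n /snd.
  have [t st] := rs_complete rsk snd'; exists t => //; apply/asboolP.
  by apply: preserves_sup snd' st _ => n; apply/asboolP; exact: (valP (s n)).
split.
- move=> s t; have [u [su tu]] := rs_directed rsk (val s) (val t).
  by have [v uv] := cofinal u; exists v; rewrite !le_sub_index !(le_trans _ uv).
- move=> s snd; have [t pt [st tleast]] := Icomp s snd.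
  exists (exist _ t pt); split => [_ [n _ <-]|u us].
    by rewrite le_sub_index; apply: st; exists n.
  by rewrite le_sub_index; apply: tleast => _ [n _ <-]; apply: us; exists n.
- by move=> s a f g; exact: Cspace_eqP.
- by move=> s f; exact: comp_contractive.
- move=> s; exact: separable_range_comp (rs_metrizable rsk (val s)).
- move=> f; have [s sf] := comp_cover rsk i0 f; have [t st] := cofinal s.
  by exists t; move: (comp_comm rsk f st).2 sf => /= Ptsf sf; rewrite sf in Ptsf.
- by move=> s t f st; exact: comp_comm.
- move=> s t sinc st f.
  have snd : nondecreasing_seq s by move=> m n; rewrite sinc.
  have snd' : nondecreasing_seq (val \o s) by move=> m n /snd.
  have [u pu su] := Icomp s snd; have tu := isLub_val pu su st.
  apply/cvgrPdist_le => e e0; rewrite tu.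
  by have [N HN] := comp_strong rsk f snd' su e0; exists N.
Qed.

End PreservingIndices.

Theorem theorem1p2 (R : realType) (K : compactHausdorffType) (D : set K)
    (hK : has_retractional_skeleton R K)
    (hD : induced_by_retractional_skeleton R D)
    (Y : nat -> set (Cspace R K))
    (Ysub : forall n, submod_closed [in Y n])
    (Ycl : forall n, closed (Y n : set (taup R D))) :
  exists (d : Order.disp_t) (I : porderType d)
      (P : I -> Cspace R K -> Cspace R K),
    r_projectional_skeleton 1 P /\
    exists PY : forall n s f, Y n f -> Y n (P s f),
      forall n,
        let Yn := ClosedSubspace (Ysub n) (taup_closed (Ycl n)) in
        r_projectional_skeleton 1 (fun s => @csub_restr R _ Yn (P s) (PY n s)).
Proof.
have [d [I [r [i0 [rsk DE]]]]] := inhabited_skeleton hD; subst D.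
have H := preserving_strong_skeleton rsk i0 Ysub Ycl.
pose p : pred I := fun s => `[< preserves rsk Y s >].
pose P (s : sub_index p) := Cspace_comp (R := R) (retract_continuous rsk (s := val s)).
have PY n s f : Y n f -> Y n (P s f) by case: s => s ps; exact: (elimT (asboolP _) ps).
exists d, (sub_index p), P; split; first exact: strong_skeleton_1projectional H.
exists PY => n Yn; apply: strong_skeleton_1projectional.
exact: (@strong_skeleton_subspace _ _ _ _ _ Yn _ H).
Qed.
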